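(* The canonical Ramsey numbers of all orderings of the path $P_4$ on $4$ vertices (up to reflection) are as follows, where each ordered graph has vertex set $1<2<3<4$ and is given by its edge set: \begin{itemize} \item $\mathrm{ER}(\{14,23,34\})=7$; \item $\mathrm{ER}(\{14,23,24\})=5$; \item $\mathrm{ER}(\{13,24,34\})=6$; \item $\mathrm{ER}(\{13,23,24\})=5$; \item $\mathrm{ER}(\{13,14,24\})=5$; \item $\mathrm{ER}(\{12,24,34\})=6$; \item $\mathrm{ER}(\{12,23,34\})=10$; \item $\mathrm{ER}(\{12,14,34\})=6$. \end{itemize}
   Context: An ordered graph is a graph with a linear order on its vertices. Here $ij$ denotes the edge between vertices $i$ and $j$. The vertices of $K_n$ are linearly ordered as $1<\dots<n$, and a copy of an ordered graph $\mathcal G$ in $K_n$ is a (not necessarily induced) subgraph isomorphic to $\mathcal G$ via an order-preserving map. An edge-colored ordered graph is canonically colored if one of the following holds: it is monochromatic (all edges have the same color); it is rainbow (all edges have pairwise different colors); it is lower lexicographically colored (two edges have the same color if and only if they have the same smaller endpoint); or it is upper lexicographically colored (two edges have the same color if and only if they have the same larger endpoint). The canonical Ramsey number $\mathrm{ER}(\mathcal G)$ is the least positive integer $n$ such that every edge-coloring of the ordered complete graph $K_n$, with an arbitrary number of colors, contains a canonically colored copy of $\mathcal G$. Reversing the vertex order of $\mathcal G$ (reflection) does not change $\mathrm{ER}(\mathcal G)$, and the eight ordered graphs listed are all orderings of $P_4$ up to reflection. *)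

(* Defs.v *)
From mathcomp Require Import all_boot.

Set Implicit Arguments.
Unset Strict Implicit.
Unset Printing Implicit Defensive.

(* An ordered graph on k vertices: the vertex set is 'I_k with its natural
   order, and each edge is recorded once, as the pair (i, j) with i < j. *)
Record ograph (k : nat) := OGraph {
  edge : rel 'I_k;
  edge_ltn : forall i j : 'I_k, edge i j -> i < j
}.

(* An edge-coloring is a map c : 'I_k -> 'I_k -> C, where c i j is the color of
   the edge ij for i < j; the values c i j with j <= i are irrelevant. *)
Section Canonical.

Variables (k : nat) (G : ograph k) (C : eqType) (c : 'I_k -> 'I_k -> C).

Definition monochromatic : Prop :=
  forall i j i' j' : 'I_k, edge G i j -> edge G i' j' -> c i j = c i' j'.

Definition rainbow : Prop :=
  forall i j i' j' : 'I_k, edge G i j -> edge G i' j' ->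
    (i, j) <> (i', j') -> c i j <> c i' j'.

Definition lower_lexicographic : Prop :=
  forall i j i' j' : 'I_k, edge G i j -> edge G i' j' ->
    (c i j = c i' j' <-> i = i').

Definition upper_lexicographic : Prop :=
  forall i j i' j' : 'I_k, edge G i j -> edge G i' j' ->
    (c i j = c i' j' <-> j = j').

Definition canonically_colored : Prop :=
  [\/ monochromatic, rainbow, lower_lexicographic | upper_lexicographic].

End Canonical.

(* A copy of G in K_n is the image of G under a strictly increasing map f;
   its coloring is transported back to G along f. *)
Definition has_canonical_copy (k : nat) (G : ograph k) (n : nat) (C : eqType)
    (c : 'I_n -> 'I_n -> C) : Prop :=
  exists f : 'I_k -> 'I_n,
    (forall i j : 'I_k, i < j -> f i < f j) /\
    canonically_colored G (fun i j => c (f i) (f j)).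

Definition ER_arrows (k : nat) (G : ograph k) (n : nat) : Prop :=
  forall (C : eqType) (c : 'I_n -> 'I_n -> C), has_canonical_copy G c.

Definition is_ER (k : nat) (G : ograph k) (n : nat) : Prop :=
  [/\ 0 < n, ER_arrows G n &
      forall m : nat, 0 < m -> ER_arrows G m -> n <= m].

Section OfEdges.

Variables (k : nat) (E : seq (nat * nat)).

(* The pairs of E use the labels 1, ..., k: label i.+1 is vertex i of 'I_k. *)
Definition of_edges_rel : rel 'I_k :=
  fun i j => (i < j) && ((i.+1, j.+1) \in E).

Lemma of_edges_ltn (i j : 'I_k) : of_edges_rel i j -> i < j.
Proof. by case/andP. Qed.

Definition of_edges : ograph k := OGraph of_edges_ltn.

End OfEdges.

(* Main.v *)
Require Import Defs.
From mathcomp Require Import all_boot.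

Set Implicit Arguments.
Unset Strict Implicit.
Unset Printing Implicit Defensive.

(** Upper bounds.  Reveal the colors of the edges of [K_n] one at a time.  Up to
    renaming, the revealed edge gets one of the [m] colors already seen or the
    new color [m], so this is a finite decision tree, and a branch can be cut as
    soon as the revealed edges contain a canonically colored copy of the graph.
    All branches get cut.  Always revealing the edge with the fewest colors that
    do not cut the branch immediately keeps the tree small (about 300 nodes for
    the monotone path in [K_10], fewer than 30 for the other paths); the
    soundness of the search does not depend on which edge is revealed.

    Lower bounds.  An explicit coloring of [K_(n-1)] without canonical copy. *)

Notation vpair := (nat * nat)%type.

(** * Canonical colorings as a boolean test *)

Section CanonicalTest.

Variable T : eqType.
Implicit Types (p : rel vpair) (s : seq (vpair * T)).

(** Each type of canonical coloring prescribes, through [p], exactly which pairs of edges share a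
    color. *)
Definition color_pattern p s : bool :=
  all (fun x => all (fun y => (x.2 == y.2) == p x.1 y.1) s) s.

Definition canonical_test s : bool :=
  [|| color_pattern (fun _ _ => true) s, color_pattern (fun e e' => e == e') s,
      color_pattern (fun e e' => e.1 == e'.1) s |
      color_pattern (fun e e' => e.2 == e'.2) s].

Lemma color_patternP (I : eqType) (E : seq I) (F : I -> vpair * T) p :
  reflect {in E &, forall x y, ((F x).2 == (F y).2) = p (F x).1 (F y).1}
          (color_pattern p (map F E)).
Proof.
rewrite /color_pattern all_map; apply: (iffP allP) => [h x y xE yE|h x xE].
  by have /= := h x xE; rewrite all_map => /allP/(_ y yE)/= /eqP.
by rewrite /= all_map; apply/allP => y yE /=; rewrite h.
Qed.

End CanonicalTest.

(** Being canonical depends only on which edges share a color, so the colors may be renamed. *)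
Lemma canonical_test_inj (T T' : eqType) (E : seq vpair) (g : vpair -> T)
    (g' : vpair -> T') :
  {in E &, forall e e', (g e == g e') = (g' e == g' e')} ->
  canonical_test [seq (e, g e) | e <- E] =
  canonical_test [seq (e, g' e) | e <- E].
Proof.
move=> gg'; have eqp p : color_pattern p [seq (e, g e) | e <- E] =
                         color_pattern p [seq (e, g' e) | e <- E].
  by apply/color_patternP/color_patternP => /= h e e' eE e'E;
    [rewrite -gg' | rewrite gg'] => //; apply: h.
by rewrite /canonical_test !eqp.
Qed.

(** [of_edges] drops pairs that are not increasing or out of range, while the boolean test reads all
    of [E]; under this condition both see the same edges. *)
Definition wf_edges (k : nat) (E : seq vpair) : bool :=
  all (fun e => (0 < e.1 < e.2) && (e.2 <= k)) E.

Section CanonicalOfEdges.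

Variables (k : nat) (E : seq vpair) (C : eqType).
Variables (c : 'I_k -> 'I_k -> C) (g : vpair -> C).
Hypothesis gE : forall i j : 'I_k, g (i.+1, j.+1) = c i j.

Lemma canonical_test_canonically_colored :
  canonical_test [seq (e, g e) | e <- E] ->
  canonically_colored (of_edges k E) c.
Proof.
case/or4P => /color_patternP /= h.
- apply: Or41 => i j i' j' /andP[_ eE] /andP[_ e'E].
  by rewrite -!gE; apply/eqP; rewrite h.
- apply: Or42 => i j i' j' /andP[_ eE] /andP[_ e'E] ne.
  rewrite -!gE => /eqP; rewrite h // xpair_eqE !eqSS => /andP[/eqP ii' /eqP jj'].
  by apply: ne; congr pair; apply: val_inj.
- apply: Or43 => i j i' j' /andP[_ eE] /andP[_ e'E]; rewrite -!gE.
  split=> [/eqP|ii]; last by apply/eqP; rewrite h //= ii.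
  by rewrite h //= eqSS => /eqP ?; apply: val_inj.
- apply: Or44 => i j i' j' /andP[_ eE] /andP[_ e'E]; rewrite -!gE.
  split=> [/eqP|ii]; last by apply/eqP; rewrite h //= ii.
  by rewrite h //= eqSS => /eqP ?; apply: val_inj.
Qed.

Lemma canonically_colored_canonical_test :
  wf_edges k E -> canonically_colored (of_edges k E) c ->
  canonical_test [seq (e, g e) | e <- E].
Proof.
move=> /allP wfE; have edgeP e : e \in E ->
    exists i j : 'I_k, e = (i.+1, j.+1) /\ of_edges_rel E i j.
  move=> eE; have := wfE e eE; case: e eE => [[|a] [|b]] //= eE.
  rewrite ltnS => /andP[ab bk].
  exists (Ordinal (leq_trans (leqW ab) bk)), (Ordinal bk).
  by split=> //; rewrite /of_edges_rel /= ab.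
move=> can; apply/or4P; case: can => h; [apply: Or41|apply: Or42|apply: Or43|
  apply: Or44]; apply/color_patternP => e e' eE e'E /=;
  have [i [j [-> ij]]] := edgeP e eE; have [i' [j' [-> ij']]] := edgeP e' e'E;
  rewrite !gE /=.
- by apply/eqP; apply: h.
- apply/eqP/eqP => [cc|[/val_inj-> /val_inj->]] //.
  have [[-> ->]//|ne] := eqVneq (i, j) (i', j').
  by have := h _ _ _ _ ij ij' (elimN eqP ne) cc.
- by rewrite eqSS; apply/eqP/eqP => [|/val_inj] /(h _ _ _ _ ij ij') // ->.
- by rewrite eqSS; apply/eqP/eqP => [|/val_inj] /(h _ _ _ _ ij ij') // ->.
Qed.

End CanonicalOfEdges.

(** * Copies of an ordered graph *)

Fixpoint subseqs (T : Type) (k : nat) (s : seq T) : seq (seq T) :=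
  match k, s with
  | 0, _ => [:: [::]]
  | _.+1, [::] => [::]
  | k'.+1, x :: s' => map (cons x) (subseqs k' s') ++ subseqs k s'
  end.

Lemma mem_subseqs (T : eqType) k (q s : seq T) :
  (q \in subseqs k s) = subseq q s && (size q == k).
Proof.
elim: s k q => [|x s IHs] [|k] q /=.
- by rewrite inE; case: q.
- by case: q.
- by rewrite inE; case: q => [|y q] //; rewrite andbF.
rewrite mem_cat IHs; case: q => [|y q].
  by rewrite !andbF orbF; apply/mapP => -[].
rewrite /= eqSS; have [->|yx] := eqVneq y x.
  rewrite mem_map => [|? ? []//]; rewrite IHs.
  (* If [x :: q] embeds in [s], so does [q], and the two alternatives collapse. *)
  case: (boolP (subseq (x :: q) s)) => [/cons_subseq->|_]; first exact: orbb.
  exact: orbF.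
by case: mapP => [[q' _ [/eqP]]|]; rewrite ?(negPf yx).
Qed.

(* The labels in [e] start at 1, the positions in [q] at 0. *)
Definition edge_image (q : seq nat) (e : vpair) : vpair :=
  (nth 0 q e.1.-1, nth 0 q e.2.-1).

Lemma canonical_test_has_canonical_copy k E n (C : eqType)
    (c : 'I_n.+1 -> 'I_n.+1 -> C) (q : seq nat) :
  q \in subseqs k (iota 0 n.+1) ->
  canonical_test
    [seq (e, let e' := edge_image q e in c (inord e'.1) (inord e'.2)) | e <- E] ->
  has_canonical_copy (of_edges k E) c.
Proof.
rewrite mem_subseqs => /andP[sub_q /eqP size_q] test_q.
exists (fun i => inord (nth 0 q i)); split=> [i j ij|].
  have lt_q (l : 'I_k) : nth 0 q l < n.+1.
    have := mem_subseq sub_q (mem_nth 0 (_ : l < size q)).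
    by rewrite size_q mem_iota; apply.
  rewrite !inordK //; apply: (sorted_ltn_nth ltn_trans) => //;
    rewrite ?inE ?size_q //.
  by apply: subseq_sorted sub_q (iota_ltn_sorted _ _); apply: ltn_trans.
exact: canonical_test_canonically_colored test_q.
Qed.

Lemma no_canonical_copy k E n (C : eqType) (c : nat -> nat -> C) :
  wf_edges k E ->
  all (fun q => ~~ canonical_test
         [seq (e, let e' := edge_image q e in c e'.1 e'.2) | e <- E])
      (subseqs k (iota 0 n)) ->
  ~ has_canonical_copy (of_edges k E) (fun i j : 'I_n => c i j).
Proof.
move=> wfE /allP noc [f [f_mono]]; set q := [seq val (f i) | i <- enum 'I_k].
have size_q : size q = k by rewrite size_map size_enum_ord.
have nth_q (i : 'I_k) : nth 0 q i = f i.
  by rewrite (nth_map i) ?size_enum_ord // nth_ord_enum.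
have sorted_q : sorted ltn q.
  apply/(sortedP 0) => i; rewrite size_q => lt_i.
  have := f_mono (Ordinal (ltnW lt_i)) (Ordinal lt_i) (ltnSn i).
  by rewrite -!nth_q.
have q_in : q \in subseqs k (iota 0 n).
  rewrite mem_subseqs size_q eqxx andbT.
  (* A strictly increasing list is determined by its set of entries. *)
  have -> : q = [seq x <- iota 0 n | x \in q]; last exact: filter_subseq.
  apply: (irr_sorted_eq ltn_trans ltnn) => // [|x].
    by apply: (sorted_filter ltn_trans); apply: iota_ltn_sorted.
  rewrite mem_filter mem_iota; case: (boolP (x \in q)) => //= /mapP[i _ ->].
  by rewrite ltn_ord.
move=> can; have /negP[] := noc q q_in.
apply: (@canonically_colored_canonical_test k E C
          (fun i j => c (f i) (f j)) _ _ wfE can) => i j.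
by rewrite /= !nth_q.
Qed.

(** * The search *)

Section Search.

Variables (k : nat) (E : seq vpair).

Implicit Types (h : seq (vpair * nat)) (e : vpair) (q : seq nat).

(* A history [h] lists the revealed edges with their colors, renamed to natural
   numbers in order of appearance; the next new color is [m]. *)
Fixpoint revealed h e : option nat :=
  if h is (e', a) :: h' then if e' == e then Some a else revealed h' e else None.

(* Here and in [refute], [if] rather than [&&] and [||], which do not cut the
   evaluation short in [vm_compute]. *)
Definition canonical_in h q : bool :=
  let s := [seq (e, revealed h (edge_image q e)) | e <- E] in
  if all (fun x => isSome x.2) s then canonical_test s else false.

Definition candidate := (vpair * seq (seq nat))%type.
Implicit Types (x y : candidate) (es : seq candidate).

(** Edges in many copies come first: [fail_first] keeps the earlier of two equal counts and so
    prefers them. *)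
Definition candidates (n : nat) : seq candidate :=
  let copies := subseqs k (iota 0 n) in
  sort (fun x y => size y.2 <= size x.2)
    [seq ((i, j), [seq q <- copies | (i, j) \in map (edge_image q) E])
       | j <- iota 0 n, i <- iota 0 j].

Definition survivors h m x : nat :=
  count (fun a => ~~ has (canonical_in ((x.1, a) :: h)) x.2) (iota 0 m.+1).

Fixpoint fail_first h m x r es : candidate :=
  if es is y :: es' then
    let r' := survivors h m y in
    if r' < r then fail_first h m y r' es' else fail_first h m x r es'
  else x.

Fixpoint refute (fuel : nat) es h m : bool :=
  if fuel is fuel'.+1 then
    (* Counts are at most [m.+1], so the dummy candidate is returned only when [es] is empty; having
       no copies, it cuts nothing. *)
    let x := fail_first h m ((0, 0), [::]) m.+2 es in
    let es' := [seq y <- es | y.1 != x.1] in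
    all (fun a => let h' := (x.1, a) :: h in
           if has (canonical_in h') x.2 then true
           else refute fuel' es' h' (maxn m a.+1))
        (iota 0 m.+1)
  else false.

Variables (C : eqType) (g : vpair -> C) (copies : seq (seq nat)).

(* [u] lists the colors of the history: color [a] stands for [nth _ u a]. *)
Definition history_of h (u : seq C) : Prop :=
  forall e a, revealed h e = Some a -> g e \in u /\ a = index (g e) u.

(** The color of [e] either occurs in [u] already or is appended with index [size u], so one of the
    branches explored follows [g]. *)
Lemma history_of_cons h u e :
  uniq u -> history_of h u ->
  exists2 a, a <= size u & exists2 u', uniq u' /\ size u' = maxn (size u) a.+1 &
    history_of ((e, a) :: h) u'.
Proof.
move=> Uu hu; case: (boolP (g e \in u)) => [gu|gu].
  exists (index (g e) u); first by rewrite ltnW ?index_mem.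
  exists u => [|e' a /=]; first by rewrite (maxn_idPl _) ?index_mem.
  by case: eqP => [<- [<-]|_ /hu].
exists (size u) => //; exists (rcons u (g e)).
  by rewrite rcons_uniq gu Uu size_rcons (maxn_idPr _).
move=> e' a /=; rewrite mem_rcons inE -cats1 index_cat.
case: eqP => [<- [<-]|_ /hu[gu' ->]]; last by rewrite gu' orbT.
by rewrite eqxx (negPf gu) /= eqxx addn0.
Qed.

Lemma canonical_in_test h u q : history_of h u -> canonical_in h q ->
  canonical_test [seq (e, g (edge_image q e)) | e <- E].
Proof.
rewrite /canonical_in => hu; case: allP => // revE.
have revP e : e \in E ->
    exists2 a, revealed h (edge_image q e) = Some a &
      g (edge_image q e) \in u /\ a = index (g (edge_image q e)) u.
  move=> eE; have := revE _ (map_f _ eE) => /=.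
  by case ra: revealed => [a|] // _; exists a => //; apply: hu.
rewrite (@canonical_test_inj _ _ _ (fun e => revealed h (edge_image q e))
           (fun e => g (edge_image q e))) //.
move=> e e' /revP[a -> [gu ->]] /revP[a' -> [gu' ->]].
apply/eqP/eqP => [[eq_index]|->//].
by rewrite -(nth_index (g e) gu) eq_index nth_index.
Qed.

Lemma fail_first_mem h m x r es : fail_first h m x r es \in x :: es.
Proof.
elim: es x r => [|y es IHes] x r /=; first by rewrite mem_head.
case: ifP => _; last by have := IHes x r; rewrite !inE orbCA => ->; rewrite orbT.
by rewrite inE IHes orbT.
Qed.

(** The coloring [g] selects one branch of the tree; the copy that cuts this branch is canonical
    under [g]. *)
Lemma refute_canonical_copy fuel es h u :
  {in es, forall x, {subset x.2 <= copies}} -> uniq u -> history_of h u ->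
  refute fuel es h (size u) ->
  exists2 q, q \in copies &
    canonical_test [seq (e, g (edge_image q e)) | e <- E].
Proof.
elim: fuel es h u => // fuel IH es h u es_copies Uu hu; cbn [refute].
set x := fail_first _ _ _ _ _ => /allP ref.
have [a a_le [u' [Uu' size_u'] hu']] := history_of_cons x.1 Uu hu.
have := ref a; rewrite mem_iota ltnS => /(_ a_le).
case: hasP => [[q qx can_q] _|_].
  exists q; last exact: canonical_in_test hu' can_q.
  have := fail_first_mem h (size u) ((0, 0), [::]) (size u).+2 es.
  by rewrite inE => /orP[/eqP x0|/es_copies]; [rewrite /x x0 in qx | apply].
by rewrite -size_u'; apply: IH => // y; rewrite mem_filter => /andP[_ /es_copies].
Qed.

End Search.

(** * From the search and a coloring to the canonical Ramsey number *)

Lemma refute_ER_arrows k E n :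
  refute E (n.+1 * n.+1) (candidates k E n.+1) [::] 0 ->
  ER_arrows (of_edges k E) n.+1.
Proof.
move=> ref C c.
have [|//|q q_copy test_q] := @refute_canonical_copy E C
  (fun e => c (inord e.1) (inord e.2)) (subseqs k (iota 0 n.+1)) _ _ _ [::]
  _ isT _ ref; last exact: canonical_test_has_canonical_copy test_q.
move=> x; rewrite mem_sort => /allpairsPdep[j [i [_ _ ->]]] q.
by rewrite mem_filter => /andP[].
Qed.

Lemma ER_arrows_leq k (G : ograph k) m n :
  m <= n -> ER_arrows G m -> ER_arrows G n.
Proof.
move=> le_mn arr C c.
have [f [f_mono can]] :=
  arr C (fun i j => c (widen_ord le_mn i) (widen_ord le_mn j)).
by exists (fun i => widen_ord le_mn (f i)).
Qed.

(** The fuel exceeds the number of edges, hence the depth of the tree. By monotonicity in the number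
    of vertices, the single coloring [c] of [K_n] excludes all smaller values. *)
Lemma is_ER_of_edges k E n (C : eqType) (c : nat -> nat -> C) :
  wf_edges k E ->
  refute E (n.+1 * n.+1) (candidates k E n.+1) [::] 0 ->
  all (fun q => ~~ canonical_test
         [seq (e, let e' := edge_image q e in c e'.1 e'.2) | e <- E])
      (subseqs k (iota 0 n)) ->
  is_ER (of_edges k E) n.+1.
Proof.
move=> wfE ref noc; split=> // [|m _ arr]; first exact: refute_ER_arrows.
rewrite ltnNge; apply/negP => le_mn; apply: (no_canonical_copy wfE noc).
exact: ER_arrows_leq le_mn arr _ _.
Qed.

(* Row [j] of the table lists the colors of the edges from [0, ..., j - 1] to
   vertex [j]. *)
Definition table_coloring (t : seq (seq nat)) (i j : nat) : nat :=
  nth 0 (nth [::] t j) i.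

Theorem mainTheorem3 :
  is_ER (of_edges 4 [:: (1, 4); (2, 3); (3, 4)]) 7 /\
  is_ER (of_edges 4 [:: (1, 4); (2, 3); (2, 4)]) 5 /\
  is_ER (of_edges 4 [:: (1, 3); (2, 4); (3, 4)]) 6 /\
  is_ER (of_edges 4 [:: (1, 3); (2, 3); (2, 4)]) 5 /\
  is_ER (of_edges 4 [:: (1, 3); (1, 4); (2, 4)]) 5 /\
  is_ER (of_edges 4 [:: (1, 2); (2, 4); (3, 4)]) 6 /\
  is_ER (of_edges 4 [:: (1, 2); (2, 3); (3, 4)]) 10 /\
  is_ER (of_edges 4 [:: (1, 2); (1, 4); (3, 4)]) 6.
Proof.
split.
  by apply: (@is_ER_of_edges _ _ _ _ (table_coloring
    [:: [::]; [:: 0]; [:: 0; 0]; [:: 0; 0; 1]; [:: 0; 0; 1; 1];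
        [:: 0; 0; 2; 1; 1]])); vm_compute.
split.
  by apply: (@is_ER_of_edges _ _ _ _ (table_coloring
    [:: [::]; [:: 0]; [:: 0; 0]; [:: 0; 1; 0]])); vm_compute.
split.
  by apply: (@is_ER_of_edges _ _ _ _ (table_coloring
    [:: [::]; [:: 0]; [:: 0; 0]; [:: 1; 0; 1]; [:: 0; 2; 0; 1]])); vm_compute.
split.
  by apply: (@is_ER_of_edges _ _ _ _ (table_coloring
    [:: [::]; [:: 0]; [:: 0; 1]; [:: 0; 0; 0]])); vm_compute.
split.
  by apply: (@is_ER_of_edges _ _ _ _ (table_coloring
    [:: [::]; [:: 0]; [:: 0; 0]; [:: 1; 0; 0]])); vm_compute.
split.
  by apply: (@is_ER_of_edges _ _ _ _ (table_coloring
    [:: [::]; [:: 0]; [:: 1; 1]; [:: 0; 0; 1]; [:: 0; 0; 1; 2]])); vm_compute.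
split.
  (* Two colors leave only the monochromatic case, as no two edges of the monotone path share a
     smaller or a larger endpoint. Such a path would need four vertices in one block of size three,
     or four distinct blocks out of three. *)
  by apply: (@is_ER_of_edges _ _ _ _ (fun i j => i %/ 3 == j %/ 3)); vm_compute.
by apply: (@is_ER_of_edges _ _ _ _ (table_coloring
  [:: [::]; [:: 0]; [:: 0; 0]; [:: 1; 0; 0]; [:: 1; 1; 0; 0]])); vm_compute.
Qed.
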